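(* There exist absolute constants $p_0\in(0,1)$, $\delta_0>0$ and $C>0$ such that the following holds. For every finite simple graph $G(V,E)$ (not necessarily bipartite) and every $p\in(0,1)$, there is a subgraph $H(V,Q)$ of $G$ (with $Q\subseteq E$) in which every vertex has degree at most $C\cdot\frac{1+\ln(1/p)}{p}$ (i.e. maximum degree $O(\log(1/p)/p)$), such that (i) if $p\le p_0$, then $\mathbb{E}[\mu(H_p)]\ge 0.52\cdot \mathbb{E}[\mu(G_p)]$; (ii) for every $p\in(0,1)$, $\mathbb{E}[\mu(H_p)]\ge (\tfrac12+\delta_0)\cdot \mathbb{E}[\mu(G_p)]$.
   Context: For a graph $G(V,E)$ and $p\in(0,1)$, a realization $G_p(V,E_p)$ of $G$ is the random subgraph obtained by keeping each edge of $E$ independently with probability $p$. For a graph $X$, $\mu(X)$ denotes the size of a maximum matching in $X$. $H_p$ denotes a realization of $H$ (each edge of $Q$ kept independently with probability $p$). *)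

(* Defs.v *)
From mathcomp Require Import all_boot.
From Stdlib Require Import Reals.

Set Implicit Arguments.
Unset Strict Implicit.
Unset Printing Implicit Defensive.

Definition simple_graph (T : finType) (E : {set {set T}}) : Prop :=
  forall e, e \in E -> #|e| = 2.

Definition is_matching (T : finType) (M : {set {set T}}) : bool :=
  [forall e1 in M, forall e2 in M, (e1 != e2) ==> [disjoint e1 & e2]].

Definition mu (T : finType) (X : {set {set T}}) : nat :=
  \max_(M in powerset X | is_matching M) #|M|.

Definition deg (T : finType) (Q : {set {set T}}) (v : T) : nat :=
  #|[set e in Q | v \in e]|.

(* Probability that the realization of the edge set E is exactly F
   (each edge kept independently with probability p). *)
Definition realization_prob (T : finType) (p : R) (E F : {set {set T}}) : R :=
  (p ^ #|F| * (1 - p) ^ (#|E| - #|F|))%R.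

Definition expect (T : finType) (p : R) (E : {set {set T}})
    (f : {set {set T}} -> nat) : R :=
  \big[Rplus/0%R]_(F in powerset E) (realization_prob p E F * INR (f F))%R.

(* Main.v *)
Require Import Defs.
From mathcomp Require Import all_boot all_order all_algebra.
From mathcomp Require Import zify ring lra Rstruct.

(** The subgraph [Q] is an edge-degree constrained subgraph: it maximizes
    [2 b |Q| - sum_v deg_Q(v)^2], so that the degree sum over an edge is at most
    [b + 1] inside [Q] and at least [b - 1] on [E \ Q].  With [b] of order [1/p]
    the degrees of the realization [X] of [Q] are close to [p deg_Q] in mean
    square, and the total squared error is a small multiple of [E mu(X)].

    Fix a realization of [E] and a maximum matching [M] of it.  A random
    bipartition separating the two ends of each edge of [M] halves all degrees of
    [X] up to a mean-square error.  Koenig's theorem gives a cover [C] of the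
    crossing edges with [|C| <= mu(X)].  The [M]-edges missed by [C] have large
    degree sums, all crossing edges of [X] at their ends lead to [C], and the
    degree sums of those are bounded; double counting yields
    [|M| <= 7/4 mu(X) + O(squared degree error)]. *)

Set Implicit Arguments.
Unset Strict Implicit.
Unset Printing Implicit Defensive.
Import Order.TTheory GRing.Theory Num.Theory.

(** * Matchings, vertex covers and Koenig's theorem *)

Section Konig.
Variable T : finType.
Implicit Types (X Y M : {set {set T}}) (C L : {set T}) (e : {set T}).

Definition covers C X := [forall e in X, ~~ [disjoint e & C]].

Lemma coversP C X : reflect (forall e, e \in X -> exists2 v, v \in e & v \in C) (covers C X).
Proof.
apply: (iffP forall_inP) => h e eX.
  by have /pred0Pn[v /andP[? ?]] := h e eX; exists v.
by have [v ve vC] := h e eX; apply/pred0Pn; exists v; apply/andP.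
Qed.

Lemma matchingP M e1 e2 v : is_matching M -> e1 \in M -> e2 \in M ->
  v \in e1 -> v \in e2 -> e1 = e2.
Proof.
move=> /forall_inP /(_ e1) mM e1M e2M v1 v2; apply/eqP; apply/negPn/negP => ne.
have /forall_inP /(_ e2 e2M) := mM e1M; rewrite ne /= => /pred0P /(_ v) /=.
by rewrite v1 v2.
Qed.

Lemma card_matching_le_mu X M : M \subset X -> is_matching M -> #|M| <= mu X.
Proof.
move=> sMX mM.
by apply: (@leq_bigmax_cond _ _ (fun M : {set {set T}} => #|M|)); rewrite powersetE sMX.
Qed.

Lemma mu_witness X : exists M, [/\ M \subset X, is_matching M & #|M| = mu X].
Proof.
have c0 : 0 < #|[pred M | (M \in powerset X) && is_matching M]|.
  apply/card_gt0P; exists set0; rewrite !inE sub0set /=.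
  by apply/forall_inP => e; rewrite inE.
have [M] := eq_bigmax_cond (fun M : {set {set T}} => #|M|) c0.
by rewrite inE powersetE => /andP[sMX mM] muE; exists M.
Qed.

(** Matching edges are disjoint, so choosing in each one a vertex of [C] is injective. *)
Lemma card_transversal_le X C : (forall e, e \in X -> exists2 v, v \in e & v \in C) ->
  is_matching X -> #|X| <= #|C|.
Proof.
move=> h mX.
have [->|[e0 e0X]] := set_0Vmem X; first by rewrite cards0.
have [v0 _ _] := h _ e0X.
pose g e := odflt v0 [pick v in e :&: C].
have gP e : e \in X -> (g e \in e) && (g e \in C).
  move=> eX; rewrite /g; case: pickP => [v|/=]; first by rewrite inE.
  by have [v ve vC] := h _ eX; move=> /(_ v); rewrite inE ve vC.
rewrite -(card_in_imset (f := g)).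
  by apply/subset_leq_card/subsetP => _ /imsetP[e eX ->]; case/andP: (gP _ eX).
move=> e1 e2 e1X e2X ge; have /andP[g1 _] := gP _ e1X; have /andP[g2 _] := gP _ e2X.
by apply: (matchingP mX e1X e2X g1); rewrite ge.
Qed.

(* Lovász: an edge-minimal graph with a given covering number is a matching.
   If two edges met at [a], the smaller colour class of [a] together with the
   symmetric difference of the two reduced covers would give too small a cover. *)
Lemma konig (L : {set T}) X :
  (forall e, e \in X -> exists a b, [/\ e = [set a; b], a \in L & b \notin L]) ->
  exists2 C, covers C X & #|C| <= mu X.
Proof.
move=> bip.
have covT : covers setT X.
  by apply/coversP => e /bip[a [b [-> _ _]]]; exists a; rewrite !inE ?eqxx.
case: (@arg_minnP _ _ (fun C => covers C X) (fun C => #|C|) covT) => C0 covC0 minC0.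
exists C0 => //; set t := #|C0| in minC0 *.
pose tight Y := (Y \subset X) && [forall C, covers C Y ==> (t <= #|C|)].
have tX : tight X by rewrite /tight subxx; apply/forallP => C; apply/implyP => /minC0.
case: (@arg_minnP _ _ tight (fun Y => #|Y|) tX) => Y /andP[sYX /forallP tY] minY.
have {}tY C : covers C Y -> t <= #|C| by move=> cC; apply: (implyP (tY C)).
(* By minimality of [Y], deleting any edge lowers the covering number below [t]. *)
have less e : e \in Y -> exists2 C, covers C (Y :\ e) & #|C| < t.
  move=> eY; have : ~~ tight (Y :\ e).
    by apply/negP => /minY; rewrite /= [X in X <= _](cardsD1 e Y) eY add1n ltnn /=.
  rewrite /tight negb_and (subset_trans (subsetDl _ _) sYX) /= negb_forall.
  by case/existsP=> C; rewrite negb_imply -ltnNge => /andP[cC ltC]; exists C.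
have mY : is_matching Y.
  apply/forall_inP => e1 e1Y; apply/forall_inP => e2 e2Y; apply/implyP => ne.
  apply/negPn/negP => /pred0Pn[a /andP[/= a1 a2]].
  have [S1 /coversP c1 l1] := less _ e1Y; have [S2 /coversP c2 l2] := less _ e2Y.
  (* A vertex of [e1] in [S1] would make [S1] a cover of all of [Y] of size below [t]. *)
  have n1 v : v \in e1 -> v \notin S1.
    move=> ve; apply/negP => vS; have /tY : covers S1 Y; last lia.
    apply/coversP => e eY; case: (eqVneq e e1) => [->|ee]; first by exists v.
    by apply: c1; rewrite !inE ee.
  have n2 v : v \in e2 -> v \notin S2.
    move=> ve; apply/negP => vS; have /tY : covers S2 Y; last lia.
    apply/coversP => e eY; case: (eqVneq e e2) => [->|ee]; first by exists v.
    by apply: c2; rewrite !inE ee.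
  pose I := S1 :&: S2; pose V := a |: ((S1 :\: S2) :|: (S2 :\: S1)).
  have cardV : #|V| <= 1 + (#|S1| - #|I|) + (#|S2| - #|I|).
    rewrite /V cardsU1 cardsU.
    have := cardsD S1 S2; have := cardsD S2 S1; rewrite -/I (setIC S2) -/I.
    by case: (a \notin _) => /=; lia.
  have leI1 : #|I| <= #|S1| by rewrite subset_leq_card ?subsetIl.
  (* An edge missing [I] has both ends in [V]: for [e1] and [e2] these are [a] and a vertex of the
     other edge's cover, and for any other edge one end lies in [S1 :\: S2] and the other in
     [S2 :\: S1]. *)
  have key e : e \in Y -> (exists2 v, v \in e & v \in I) \/ {subset e <= V}.
    move=> eY; case: (boolP [exists v in e, v \in I]) => [/exists_inP|nI]; first by left.
    right; have nI' v : v \in e -> ~ (v \in S1 /\ v \in S2).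
      by move=> ve [v1 v2]; case/negP: nI; apply/exists_inP; exists v; rewrite ?inE ?v1.
    have [x [y [exy _ _]]] := bip e (subsetP sYX _ eY).
    have [ee1|ne1] := eqVneq e e1.
      have [w we wS] : exists2 v, v \in e & v \in S2 by apply: c2; rewrite !inE eY ee1 ne.
      move: (n1 w) (n2 a a2); rewrite -ee1 => /(_ we) w1 aS2.
      move: a1; rewrite -ee1 => a1.
      have wa : w != a by apply: contraNneq aS2 => <-.
      move=> v; move: a1 we; rewrite exy !inE => a1 we ve.
      suff /orP[/eqP->|/eqP->] : (v == a) || (v == w) by rewrite ?eqxx // wS w1 /= orbT.
      move: ve a1 we wa; do 3![case/orP=> /eqP->]; rewrite ?eqxx ?orbT //.
    have [ee2|ne2] := eqVneq e e2.
      have [w we wS] : exists2 v, v \in e & v \in S1 by apply: c1; rewrite !inE eY ne1.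
      move: (n2 w) (n1 a a1); rewrite -ee2 => /(_ we) w1 aS2.
      move: a2; rewrite -ee2 => a2.
      have wa : w != a by apply: contraNneq aS2 => <-.
      move=> v; move: a2 we; rewrite exy !inE => a2 we ve.
      suff /orP[/eqP->|/eqP->] : (v == a) || (v == w) by rewrite ?eqxx // wS w1 /= orbT.
      move: ve a2 we wa; do 3![case/orP=> /eqP->]; rewrite ?eqxx ?orbT //.
    have [w we wS] : exists2 v, v \in e & v \in S1 by apply: c1; rewrite !inE eY ne1.
    have [u ue uS] : exists2 v, v \in e & v \in S2 by apply: c2; rewrite !inE eY ne2.
    have w2 : w \notin S2 by apply/negP => w2; apply: (nI' w).
    have u1 : u \notin S1 by apply/negP => u1; apply: (nI' u).
    have wu : w != u by apply: contraNneq u1 => <-.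
    move=> v; move: we ue; rewrite exy !inE => we ue ve.
    suff /orP[/eqP->|/eqP->] : (v == w) || (v == u) by rewrite ?wS ?uS ?w2 ?u1 /= !orbT.
    move: ve we ue wu; do 3![case/orP=> /eqP->]; rewrite ?eqxx ?orbT //.
  have cov (Z : {set T}) : (forall e, e \in X -> exists2 v, v \in e & v \in Z) ->
      t <= #|I| + #|V :&: Z|.
    move=> hZ; apply: (leq_trans (tY (I :|: (V :&: Z)) _)); last by rewrite cardsU; lia.
    apply/coversP => e eY; case: (key e eY) => [[v ve vI]|sV].
      by exists v; rewrite // inE vI.
    have [v ve vZ] := hZ e (subsetP sYX _ eY).
    by exists v; rewrite // in_setU in_setI vZ sV ?orbT.
  have tL := cov L; have tR := cov (~: L).
  have cVL := cardsID L V; rewrite setDE in cVL.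
  (* Adding the two bounds gives [2t <= 2|I| + |V| <= 1 + |S1| + |S2| <= 2t - 1], a
     contradiction. *)
  suff : t <= #|I| + #|V :&: L| /\ t <= #|I| + #|V :&: ~: L|.
    case; move: l1 l2 cardV leI1 cVL; rewrite -/I; lia.
  split; [apply: tL | apply: tR] => e /bip[x [y [-> xL yL]]].
    by exists x; rewrite ?inE ?eqxx.
  by exists y; rewrite ?inE ?eqxx ?orbT.
apply: leq_trans (card_matching_le_mu sYX mY).
(* One end per edge already covers [Y], whence [t <= #|Y|]. *)
pose g e := [pick v in e].
pose C := [set v | [exists e in Y, g e == Some v]].
have cC : covers C Y.
  apply/coversP => e eY; have [a [b [eab _ _]]] := bip e (subsetP sYX _ eY).
  have [v ve gv] : exists2 v, v \in e & g e = Some v.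
    rewrite /g; case: pickP => [v ve|/(_ a)]; first by exists v.
    by rewrite eab !inE eqxx.
  by exists v => //; rewrite inE; apply/exists_inP; exists e; rewrite ?gv.
apply: leq_trans (tY C cC) _; rewrite -(card_imset _ (@Some_inj _)).
apply: leq_trans (leq_imset_card g (mem Y)); apply/subset_leq_card/subsetP.
move=> _ /imsetP[v vC ->]; move: vC; rewrite inE => /exists_inP[e eY /eqP <-].
exact: imset_f.
Qed.

End Konig.

(** * Random subsets with independent elements: expectation, marginals, variance *)

Section RandomSubset.
Local Open Scope ring_scope.
Variables (R : realFieldType) (S : finType) (p : R).
Hypothesis p01 : 0 <= p <= 1.
Implicit Types (A E F Q : {set S}) (f g : {set S} -> R).

Definition Ex E f : R :=
  \sum_(F in powerset E) p ^+ #|F| * (1 - p) ^+ (#|E| - #|F|) * f F.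

(** Conditioning on whether [e] is kept; this recursion carries every induction on the ground set
    below. *)
Lemma ExU1 E e f : e \notin E ->
  Ex (e |: E) f = p * Ex E (fun F => f (e |: F)) + (1 - p) * Ex E f.
Proof.
move=> eE; rewrite /Ex (bigID (fun F : {set S} => e \in F)) /=; congr (_ + _).
  rewrite (reindex_onto (fun F => e |: F) (fun F => F :\ e)) /=; last first.
    by move=> F /andP[_ eF]; rewrite setD1K.
  rewrite big_distrr /=; apply: eq_big => F.
    rewrite !powersetE setU11 andbT; apply/andP/idP => [[sFE /eqP eqF]|sFE].
      rewrite -eqF; apply/subsetP => x; rewrite !inE => /andP[xe].
      by rewrite (negPf xe) /= => xF; move/subsetP: sFE => /(_ x); rewrite !inE (negPf xe) xF /=; apply.
    split; first exact: setUS.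
    by rewrite setU1K //; apply: contra eE; apply: (subsetP sFE).
  move=> /andP[_ /eqP eqF].
  have eF : e \notin F by rewrite -eqF !inE eqxx.
  by rewrite !cardsU1 eE eF /= !add1n subSS exprS !mulrA.
rewrite big_distrr /=; apply: eq_big => F.
  rewrite !powersetE; apply/andP/idP => [[sFE eF]|sFE].
    apply/subsetP => x xF; move/subsetP: sFE => /(_ x xF); rewrite !inE.
    by case/orP=> // /eqP xe; rewrite xe (negPf eF) in xF.
  split; last by apply: contra eE; apply: (subsetP sFE).
  exact: subset_trans sFE (subsetU1 _ _).
rewrite powersetE => /andP[sFE eF].
have sFE' : F \subset E.
  apply/subsetP => x xF; move/subsetP: sFE => /(_ x xF); rewrite !inE.
  by case/orP=> // /eqP xe; rewrite xe (negPf eF) in xF.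
rewrite cardsU1 eE add1n subSn ?subset_leq_card // exprS; ring.
Qed.

Lemma Ex0 f : Ex set0 f = f set0.
Proof.
rewrite /Ex (eq_bigl (pred1 set0)); last by move=> F; rewrite powersetE subset0.
by rewrite big_pred1_eq cards0 !expr0 !mul1r.
Qed.

Lemma ExD E f g : Ex E (fun F => f F + g F) = Ex E f + Ex E g.
Proof. by rewrite -big_split; apply: eq_bigr => F _; rewrite mulrDr. Qed.

Lemma ExZ E c f : Ex E (fun F => c * f F) = c * Ex E f.
Proof. by rewrite big_distrr; apply: eq_bigr => F _ /=; ring. Qed.

Lemma Ex_sum (I : finType) E (f : I -> {set S} -> R) :
  Ex E (fun F => \sum_i f i F) = \sum_i Ex E (f i).
Proof.
by rewrite exchange_big /=; apply: eq_bigr => F _; rewrite big_distrr.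
Qed.

Lemma eq_Ex E f g : (forall F, F \subset E -> f F = g F) -> Ex E f = Ex E g.
Proof. by move=> fg; apply: eq_bigr => F; rewrite powersetE => /fg ->. Qed.

Lemma le_Ex E f g : (forall F, F \subset E -> f F <= g F) -> Ex E f <= Ex E g.
Proof.
case/andP: p01 => p0 p1 fg; apply: ler_sum => F; rewrite powersetE => /fg fgF.
by apply: ler_wpM2l fgF; rewrite mulr_ge0 ?exprn_ge0 ?subr_ge0.
Qed.

Lemma set_card_ind (P : {set S} -> Prop) :
  P set0 -> (forall e E, e \notin E -> P E -> P (e |: E)) -> forall E, P E.
Proof.
move=> P0 PU E; have [n] := ubnP #|E|; elim: n E => // n IHn E leEn.
have [->//|[e eE]] := set_0Vmem E.
rewrite -(setD1K eE); apply: PU; first by rewrite !inE eqxx.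
by apply: IHn; move: leEn; rewrite (cardsD1 e E) eE.
Qed.

Lemma Ex_cst E c : Ex E (fun=> c) = c.
Proof.
elim/set_card_ind: E => [|e E eE IH]; first exact: Ex0.
by rewrite ExU1 // IH; ring.
Qed.

(** The elements of [E :\: Q] are integrated out one at a time: both outcomes of such an element
    give the same [F :&: Q]. *)
Lemma Ex_marginal Q E f : Q \subset E -> Ex E (fun F => f (F :&: Q)) = Ex Q f.
Proof.
move=> sQE; have -> : E = (E :\: Q) :|: Q by rewrite -{1}(setID E Q) (setIidPr sQE) setUC.
have : [disjoint E :\: Q & Q] by rewrite -setI_eq0 setIDAC setDIl setDv setI0.
elim/set_card_ind: (E :\: Q) => [_|e A eA IH].
  rewrite set0U; apply: eq_Ex => F sFQ; by rewrite (setIidPl sFQ).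
rewrite -setI_eq0 setIUl setU_eq0 !setI_eq0 disjoints1 => /andP[eQ dAQ].
rewrite -setUA ExU1; last by rewrite !inE negb_or eA.
rewrite (_ : Ex _ (fun F => f ((e |: F) :&: Q)) = Ex (A :|: Q) (fun F => f (F :&: Q))).
  by rewrite IH //; ring.
apply: eq_Ex => F _; congr f; apply/setP => x; rewrite !inE.
by case: eqP => [->|//]; rewrite (negPf eQ) !andbF.
Qed.

Lemma Ex_card E : Ex E (fun F => #|F|%:R) = p * #|E|%:R.
Proof.
elim/set_card_ind: E => [|e E eE IH]; first by rewrite Ex0 cards0 mulr0.
rewrite ExU1 // cardsU1 eE IH natrD.
rewrite (@eq_Ex _ _ (fun F => 1 + #|F|%:R)) ?ExD ?Ex_cst ?IH /=; first by ring.
move=> F sFE; rewrite cardsU1 natrD; case: (boolP (e \in F)) => // eF.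
by rewrite (subsetP sFE _ eF) in eE.
Qed.

Lemma Ex_var E : Ex E (fun F => (#|F|%:R - p * #|E|%:R) ^+ 2) = p * (1 - p) * #|E|%:R.
Proof.
elim/set_card_ind: E => [|e E eE IH].
  by rewrite Ex0 cards0 !mulr0 subr0 expr0n.
set m : R := p * #|E|%:R in IH *.
have EY : Ex E (fun F => #|F|%:R - m) = 0.
  by rewrite ExD Ex_cst Ex_card subrr.
rewrite ExU1 // cardsU1 eE natrD mulrDr mulr1 -/m /=.
(* Both squares are expanded around the old mean [m], so that the cross terms vanish by [EY]. *)
rewrite (@eq_Ex _ _ (fun F => (#|F|%:R - m) ^+ 2 + (2 * (1 - p) * (#|F|%:R - m) + (1 - p) ^+ 2))); last first.
  move=> F sFE; rewrite cardsU1 natrD; case: (boolP (e \in F)) => eF /=; last by ring.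
  by rewrite (subsetP sFE _ eF) in eE.
rewrite [X in _ + _ * X](@eq_Ex _ _ (fun F => (#|F|%:R - m) ^+ 2 + (- (2 * p) * (#|F|%:R - m) + p ^+ 2))); last first.
  by move=> F sFE; ring.
rewrite !ExD !ExZ !Ex_cst EY IH; ring.
Qed.

End RandomSubset.

(** * Edge-degree constrained subgraphs and the bipartite matching bound *)

Section EDCS.
Local Open Scope ring_scope.
Variables (R : realFieldType) (T : finType).
Implicit Types (E H X M : {set {set T}}) (A C L : {set T}) (e : {set T}).

Lemma sum_incidence X (D : T -> R) :
  \sum_(e in X) \sum_(v in e) D v = \sum_v (deg X v)%:R * D v.
Proof.
rewrite (exchange_big_dep predT) //=; apply: eq_bigr => v _.
rewrite (eq_bigl (mem [set e in X | v \in e])); last by move=> e; rewrite !inE.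
by rewrite sumr_const mulr_natl.
Qed.

Lemma degU1 H e v : e \notin H -> deg (e |: H) v = ((v \in e) + deg H v)%N.
Proof.
move=> eH; rewrite /deg; case: (boolP (v \in e)) => ve.
  rewrite (_ : [set _ in _ | _] = e |: [set x in H | v \in x]).
    by rewrite cardsU1 !inE (negPf eH).
  by apply/setP => x; rewrite !inE; case: eqP => // ->.
congr #|pred_of_set _|; apply/setP => x; rewrite !inE.
by case: eqP => // ->; rewrite (negPf ve) !andbF.
Qed.

(* Local optimality of this potential under the insertion and the deletion of
   one edge is exactly the pair of degree-sum conditions. *)
Lemma edcs_exists (b : R) E : simple_graph E -> exists H,
  [/\ H \subset E,
      forall e, e \in H -> \sum_(v in e) (deg H v)%:R <= b + 1
    & forall e, e \in E -> e \notin H -> b - 1 <= \sum_(v in e) (deg H v)%:R].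
Proof.
move=> sE; pose Phi H : R := 2 * b * #|H|%:R - \sum_v (deg H v)%:R ^+ 2.
have sum1 e : e \in E -> \sum_(v in e) (1 : R) = 2.
  by move=> eE; rewrite sumr_const (sE _ eE).
(* Inserting [e] gains [2 (b - 1 - s)], where [s] is the degree sum of [e] before the insertion. *)
have PhiU H e : e \in E -> e \notin H ->
    Phi (e |: H) = Phi H + 2 * b - 2 - 2 * \sum_(v in e) (deg H v)%:R.
  move=> eE eH; rewrite /Phi cardsU1 eH natrD /=.
  rewrite (eq_bigr (fun v => (deg H v)%:R ^+ 2 +
     (if v \in e then 1 + 2 * (deg H v)%:R else 0 : R))); last first.
    by move=> v _; rewrite degU1 // natrD; case: (v \in e) => /=; ring.
  rewrite big_split /= -big_mkcond /= big_split /= sum1 // -big_distrr /=; ring.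
have [H sHE maxH] := @arg_maxP _ R _ set0 (fun H => H \subset E) Phi (sub0set E).
exists H; split=> // e.
  move=> eH; have eE := subsetP sHE _ eH.
  have eH' : e \notin H :\ e by rewrite !inE eqxx.
  have := PhiU (H :\ e) e eE eH'; rewrite setD1K // => PhiE.
  have := maxH (H :\ e) (subset_trans (subsetDl _ _) sHE); rewrite /= PhiE.
  (* Each end of [e] loses one degree on deletion; this shift by 2 turns [b - 1] into [b + 1]. *)
  have -> : \sum_(v in e) (deg H v)%:R = 2 + \sum_(v in e) (deg (H :\ e) v)%:R :> R.
    rewrite -(sum1 e eE) -big_split /=; apply: eq_bigr => v ve.
    by have := degU1 v eH'; rewrite setD1K // ve => ->; rewrite natrD.
  lra.
move=> eE eH; have := maxH (e |: H); rewrite subUset sub1set eE sHE => /(_ isT).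
rewrite /= PhiU //; lra.
Qed.

Lemma matching_trivIset M : is_matching M -> trivIset M.
Proof.
move=> mM; apply/trivIsetP => e1 e2 e1M e2M ne; rewrite -setI_eq0; apply/eqP/setP=> v.
rewrite !inE; apply/negP => /andP[v1 v2].
by rewrite (matchingP mM e1M e2M v1 v2) eqxx in ne.
Qed.

(** The inequality of arithmetic and geometric means; it trades an absolute error for a squared one,
    at a small additive cost [d] per vertex. *)
Lemma normr_le_sqr (x d : R) : 0 < d -> `|x| <= d + x ^+ 2 / (4 * d).
Proof.
move=> d0; have d40 : 0 < 4 * d by lra.
rewrite -(ler_pM2r d40) [leRHS]mulrDl divfK ?gt_eqF //.
have : 0 <= (`|x| - 2 * d) ^+ 2 by exact: sqr_ge0.
rewrite -(real_normK (num_real x)); nra.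
Qed.

Lemma sum_deg_transversal X A : (forall e, e \in X -> #|e :&: A| = 1%N) ->
  \sum_(v in A) (deg X v)%:R = #|X|%:R :> R.
Proof.
move=> h; transitivity (\sum_v (deg X v)%:R * (if v \in A then 1 else 0 : R)).
  by rewrite big_mkcond; apply: eq_bigr => v _; case: ifP; rewrite ?mulr1 ?mulr0.
rewrite -sum_incidence -sum1_card natr_sum; apply: eq_bigr => e eX.
rewrite -big_mkcondr /= -[RHS](congr1 (fun n => n%:R) (h e eX)) -sumr_const.
by apply: eq_bigl => v; rewrite inE.
Qed.

(** [D] is an idealized degree of [Y] in units of [B]. With [C] a Koenig cover, [Mu] the edges of
    [M] that miss it and [A] their ends, the normalized number [W] of edges of [Y] at [A] is bounded
    from below through [A] and from above through the edge sums of [D]. *)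
Lemma bipartite_edcs_bound (Y M : {set {set T}}) L (B : R) (D : T -> R) :
  0 < B -> (forall v, 0 <= D v) ->
  (forall e, e \in Y -> exists a b, [/\ e = [set a; b], a \in L & b \notin L]) ->
  is_matching M -> simple_graph M ->
  (forall e, e \in Y -> \sum_(v in e) D v <= 1) ->
  (forall e, e \in M -> e \notin Y -> 15 / 16 <= \sum_(v in e) D v) ->
  #|M|%:R <= 7 / 4 * (mu Y)%:R + 86 * \sum_v ((deg Y v)%:R / B - D v) ^+ 2.
Proof.
move=> B0 D0 bip mM sM DY DM.
have [C /coversP covC leC] := konig bip.
pose Mu := [set e in M | [disjoint e & C]].
have sMu : Mu \subset M by apply/subsetP => e; rewrite inE => /andP[].
have tMu : trivIset Mu by apply: trivIsetS sMu (matching_trivIset mM).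
pose A := cover Mu.
have leM : (#|M| <= #|C| + #|Mu|)%N.
  rewrite -(cardsID Mu M) addnC (setIidPr sMu) leq_add2r.
  apply: card_transversal_le.
    move=> e; rewrite !inE negb_and => /andP[+ eM]; rewrite eM /=.
    by case/pred0Pn=> v /andP[/= ve vC]; exists v.
  apply/forall_inP => e1; rewrite inE => /andP[_ e1M].
  apply/forall_inP => e2; rewrite inE => /andP[_ e2M].
  by move/forall_inP: mM => /(_ e1 e1M) /forall_inP /(_ e2 e2M).
have cardA : #|A| = (2 * #|Mu|)%N.
  have /eqP <- := tMu; rewrite (eq_bigr (fun=> 2%N)) ?sum_nat_const 1?mulnC //.
  by move=> e eMu; apply: sM; apply: (subsetP sMu).
have AC0 v : v \in A -> v \notin C.
  move=> /bigcupP[e]; rewrite inE => /andP[_ /pred0P /(_ v) /=] + ve.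
  by rewrite ve /= => ->.
(* Since [A] avoids the cover, each of these edges has exactly one end in [A] and one in [C], so
   both sides count the same total [W]. *)
pose Y' := [set e in Y | ~~ [disjoint e & A]].
have Y'P e : e \in Y' -> exists a c, [/\ e = [set a; c], a \in A & c \in C].
  rewrite inE => /andP[eY /pred0Pn[a /andP[/= ae aA]]].
  have [c ce cC] := covC _ eY; exists a, c; split=> //.
  have ac : a != c by apply: contraTneq cC => <-; apply: AC0.
  have [x [y [exy _ _]]] := bip e eY.
  apply/eqP; rewrite eq_sym eqEcard; apply/andP; split.
    by apply/subsetP => z; rewrite !inE => /orP[] /eqP->.
  by rewrite cards2 ac exy cards2; case: (x != y).
have cA e : e \in Y' -> #|e :&: A| = 1%N.
  case/Y'P=> a [c [-> aA cC]]; rewrite (_ : _ :&: _ = [set a]) ?cards1 //.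
  apply/setP => z; rewrite !inE; case: eqP => [->|_] /=; first by rewrite aA.
  by case: eqP => // ->; apply/negP => /AC0; rewrite cC.
have cC e : e \in Y' -> #|e :&: C| = 1%N.
  case/Y'P=> a [c [-> aA cC]]; rewrite (_ : _ :&: _ = [set c]) ?cards1 //.
  apply/setP => z; rewrite !inE orbC; case: eqP => [->|_] /=; first by rewrite cC.
  by case: eqP => // ->; apply/negP; apply/negP/AC0.
pose err v : R := `|(deg Y v)%:R / B - D v|.
pose y v : R := (deg Y' v)%:R / B.
have degY' v : (deg Y' v <= deg Y v)%N.
  by apply: subset_leq_card; apply/subsetP => e; rewrite !inE => /andP[/andP[-> _] ->].
have degA v : v \in A -> deg Y' v = deg Y v.
  move=> vA; congr #|pred_of_set _|; apply/setP => e; rewrite !inE.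
  case: (boolP (v \in e)) => ve; rewrite ?andbF ?andbT // andbC.
  by suff -> : ~~ [disjoint e & A] by []; apply/pred0Pn; exists v; apply/andP.
pose W : R := #|Y'|%:R / B.
have WA : \sum_(v in A) y v = W by rewrite -mulr_suml sum_deg_transversal.
have WC : \sum_(v in C) y v = W by rewrite -mulr_suml sum_deg_transversal.
have disAC : [disjoint A & C].
  by apply/pred0P => v /=; apply/negP => /andP[/AC0/negP].
have sumAC (f : T -> R) : \sum_(v in A :|: C) f v = \sum_(v in A) f v + \sum_(v in C) f v.
  by rewrite -bigU //; apply: eq_bigl => v; rewrite !inE.
have y0 v : 0 <= y v by rewrite divr_ge0 // ltW.
(* The product is at least the square of the smaller factor, [x ^ 2 >= x - 1/4], and [D v] falls
   below [y v] by at most [err v]. *)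
have lo v : y v - 4^-1 - err v <= y v * D v.
  have yz : y v <= (deg Y v)%:R / B by rewrite ler_pM2r ?invr_gt0 // ler_nat.
  have e1 : (deg Y v)%:R / B - D v <= err v by exact: ler_norm.
  have e0 : 0 <= err v by exact: normr_ge0.
  have yr : y v - D v <= err v by lra.
  move: (y v) (D v) (err v) (y0 v) (D0 v) yr e0 => a d r a0 d0 ar r0.
  have [da|/ltW ad] := leP d a.
    have h1 : 0 <= d * (a - d) by rewrite mulr_ge0 ?subr_ge0.
    have h2 : 0 <= (2 * d - 1) * (2 * d - 1) by rewrite -expr2 sqr_ge0.
    nra.
  have h1 : 0 <= a * (d - a) by rewrite mulr_ge0 ?subr_ge0.
  have h2 : 0 <= (2 * a - 1) * (2 * a - 1) by rewrite -expr2 sqr_ge0.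
  nra.
have up : \sum_(v in A :|: C) y v * D v <= W.
  apply: (@le_trans _ _ (\sum_v y v * D v)).
    rewrite [leRHS](bigID (mem (A :|: C))) /= lerDl sumr_ge0 // => v _.
    exact: mulr_ge0.
  rewrite (eq_bigr (fun v => (deg Y' v)%:R * D v / B)); last first.
    by move=> v _; rewrite /y; ring.
  rewrite -mulr_suml -sum_incidence ler_pM2r ?invr_gt0 //.
  rewrite -sum1_card natr_sum; apply: ler_sum => e; rewrite inE => /andP[eY _].
  exact: DY.
have cAC : #|A :|: C|%:R = 2 * #|Mu|%:R + #|C|%:R :> R.
  have := cardsUI A C; move/disjoint_setI0: disAC => ->; rewrite cards0 addn0 => ->.
  by rewrite cardA natrD natrM.
pose ES := \sum_(v in A :|: C) err v.
(* Summing [lo] over [A] and [C] counts [W] twice, while [up] allows it once. *)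
have step1 : W <= (2 * #|Mu|%:R + #|C|%:R) / 4 + ES.
  have := le_trans (ler_sum _ (fun v _ => lo v)) up.
  rewrite !sumrB sumr_const -[_ *+ #|_|]mulr_natl cAC sumAC WA WC -/ES; lra.
have step2 : #|Mu|%:R * (15 / 16) <= W + ES.
  have -> : #|Mu|%:R * (15 / 16) = \sum_(e in Mu) (15 / 16) :> R.
    by rewrite sumr_const mulr_natl.
  apply: (@le_trans _ _ (\sum_(e in Mu) \sum_(v in e) D v)).
    apply: ler_sum => e; rewrite inE => /andP[eM dC]; apply: DM => //.
    apply/negP => /covC[v ve vC]; move/pred0P: dC => /(_ v) /=.
    by rewrite ve vC.
  rewrite -big_trivIset // -/A.
  apply: (@le_trans _ _ (\sum_(v in A) (y v + err v))).
    apply: ler_sum => v vA; rewrite /y degA //.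
    have : - ((deg Y v)%:R / B - D v) <= err v by rewrite ler_normr lexx orbT.
    lra.
  rewrite big_split /= WA lerD2l /ES sumAC lerDl sumr_ge0 // => v _.
  exact: normr_ge0.
(* With [d = 1/64], the three steps give [12/32 |Mu| <= 9/32 |C| + 32 S] for the squared error [S],
   so [|Mu| <= 3/4 |C| + 86 S]. *)
have step3 : ES <= (2 * #|Mu|%:R + #|C|%:R) / 64 + 16 * \sum_v ((deg Y v)%:R / B - D v) ^+ 2.
  apply: (@le_trans _ _ (\sum_(v in A :|: C) (1 / 64 + 16 * ((deg Y v)%:R / B - D v) ^+ 2))).
    apply: ler_sum => v _; have := @normr_le_sqr ((deg Y v)%:R / B - D v) (1 / 64).
    rewrite (_ : 4 * (1 / 64) = 16^-1 :> R); last by field.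
    rewrite invrK /err => h; have := h _; lra.
  rewrite big_split /= sumr_const -[_ *+ #|_|]mulr_natl cAC mul1r lerD2l -big_distrr /=.
  apply: ler_wpM2l; first by lra.
  by rewrite [leRHS](bigID (mem (A :|: C))) /= lerDl sumr_ge0 // => v _; apply: sqr_ge0.
have S0 : 0 <= \sum_v ((deg Y v)%:R / B - D v) ^+ 2.
  by apply: sumr_ge0 => v _; apply: sqr_ge0.
move: leM leC; rewrite -(ler_nat R) -(ler_nat R #|C|) natrD => leM leC.
lra.
Qed.

End EDCS.

(** * Random bipartitions that cut every edge of a matching *)

Section RandomBipartition.
Local Open Scope ring_scope.
Variables (R : realFieldType) (T : finType) (M : {set {set T}}).
Hypotheses (mM : is_matching M) (sM : simple_graph M).
Implicit Types (X : {set {set T}}) (e : {set T}) (w : {ffun T -> bool}).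

(** The two ends of an edge of [M] share a representative, one of them; an unmatched vertex
    represents itself. One random bit per representative then decides the side of both ends. *)
Definition rep (v : T) : T :=
  if [pick e in M | v \in e] is Some e then odflt v [pick u in e] else v.

Lemma rep_edge a b : [set a; b] \in M -> rep a = rep b.
Proof.
move=> abM; rewrite /rep.
have h v : v \in [set a; b] -> [pick e in M | v \in e] = Some [set a; b].
  move=> vab; case: pickP => [e /andP[eM ve]|/(_ [set a; b])].
    by rewrite (matchingP mM eM abM ve vab).
  by rewrite /= abM vab.
rewrite !h ?inE ?eqxx ?orbT //.
by case: pickP => [//|/(_ a)]; rewrite !inE eqxx.
Qed.

Lemma rep_neq v : rep v != v -> [set v; rep v] \in M.
Proof.
rewrite /rep; case: pickP => [e /andP[eM ve]|_]; last by rewrite eqxx.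
case: pickP => [u ue /= uv|_]; last by rewrite eqxx.
suff -> : [set v; u] = e by [].
apply/eqP; rewrite eqEcard cards2 (sM eM) eq_sym uv andbT.
by apply/subsetP => z; rewrite !inE => /orP[] /eqP->.
Qed.

Lemma rep_flip u v : u != v -> rep u = rep v -> (rep u != u) = ~~ (rep v != v).
Proof.
move=> uv ruv; case: (eqVneq (rep u) u) (eqVneq (rep v) v) => [ru|ru] [rv|rv] //=.
  by rewrite -ru -rv ruv eqxx in uv.
have := matchingP (v := rep u) mM (rep_neq ru) (rep_neq rv).
rewrite !inE -ruv eqxx !orbT => /(_ isT isT) /esym E.
have : v \in [set v; rep u] by rewrite !inE eqxx.
by rewrite E !inE [v == u]eq_sym (negPf uv) /= => /eqP vr; rewrite -ruv -vr eqxx in rv.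
Qed.

Definition side w v : bool := w (rep v) (+) (rep v != v).

Definition chi w v : R := (-1) ^+ side w v.

(** Matched vertices always have opposite signs. For different representatives, toggling the bit of
    [rep u] negates every term, so the sum equals its own opposite. *)
Lemma sum_chi2 u v : u != v -> \sum_w chi w u * chi w v <= 0.
Proof.
move=> uv; have [ruv|ruv] := eqVneq (rep u) (rep v).
  apply: sumr_le0 => w _; rewrite /chi -signr_addb /side ruv.
  have := rep_flip uv ruv; rewrite ruv => ->.
  by case: (w _); case: (rep v != v); rewrite /= expr1 lerN10.
pose tog w : {ffun T -> bool} := [ffun x => w x (+) (x == rep u)].
have togK : involutive tog.
  by move=> w; apply/ffunP => x; rewrite !ffunE -addbA addbb addbF.
rewrite le_eqVlt; apply/orP; left; apply/eqP.
have opp0 (s : R) : s = - s -> s = 0 by lra.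
apply: opp0; rewrite {1}(reindex_inj (inv_inj togK)) -sumrN; apply: eq_bigr => w _.
rewrite /chi /side !ffunE eqxx [rep v == rep u]eq_sym (negPf ruv) addbF.
by rewrite !signr_addb expr1 mulrN1 !mulNr.
Qed.

Definition left_side w : {set T} := [set v | side w v].

Definition crossing w X : {set {set T}} :=
  [set e in X | ~~ (e \subset left_side w) && ~~ [disjoint e & left_side w]].

Lemma crossing2 w X a b :
  ([set a; b] \in crossing w X) = ([set a; b] \in X) && (side w a (+) side w b).
Proof.
rewrite inE; congr (_ && _).
rewrite subUset !sub1set -setI_eq0 setIUl setU_eq0 !setI_eq0 !disjoints1 !inE.
by case: (side w a); case: (side w b).
Qed.

Lemma matching_crossing w e X : e \in M -> e \in X -> e \in crossing w X.
Proof.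
move=> eM; have /eqP/cards2P[a [b [ab eE]]] := sM eM; rewrite eE in eM *; move=> abX.
rewrite crossing2 abX /= /side -(rep_edge eM) {2}(rep_edge eM).
have := rep_flip ab (rep_edge eM); rewrite -(rep_edge eM) => ->.
by case: (w _); case: (_ != _).
Qed.

Lemma crossing_bip w X e : simple_graph X -> e \in crossing w X ->
  exists a b, [/\ e = [set a; b], a \in left_side w & b \notin left_side w].
Proof.
move=> sX eX; have /eqP/cards2P[a [b [ab eE]]] : #|e| = 2 by apply: sX; move: eX; rewrite inE => /andP[].
move: eX; rewrite eE crossing2 => /andP[_].
case sa: (side w a); case sb: (side w b) => //= _.
  by exists a, b; rewrite !inE sa sb.
by exists b, a; rewrite !inE sa sb setUC.
Qed.

(* Distinct edges at a vertex cross independently or, when their other ends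
   are matched to each other, in a negatively correlated way. *)
Lemma crossing_deg_var X v : simple_graph X ->
  \sum_w (2 * (deg (crossing w X) v)%:R - (deg X v)%:R) ^+ 2
    <= #|{ffun T -> bool}|%:R * (deg X v)%:R :> R.
Proof.
move=> sX; set Xv := [set e in X | v \in e].
pose xi w e : R := if e \in crossing w X then 1 else -1.
have degE w : 2 * (deg (crossing w X) v)%:R - (deg X v)%:R = \sum_(e in Xv) xi w e.
  rewrite (eq_bigr (fun e => 2 * (if e \in crossing w X then 1 else 0) - 1 : R)); last first.
    by move=> e _; rewrite /xi; case: ifP => _; ring.
  rewrite sumrB sumr_const -big_distrr /=; congr (2 * _ - _).
  rewrite -big_mkcondr /= sumr_const; congr (_%:R); apply: eq_card => e; rewrite !inE.
  rewrite [RHS]unfold_in !inE.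
  by case: (e \in X); case: (v \in e); rewrite ?andbF ?andbT.
rewrite (eq_bigr (fun w => \sum_(e in Xv) \sum_(f in Xv) xi w e * xi w f)); last first.
  by move=> w _; rewrite degE expr2 big_distrlr.
rewrite exchange_big /= -/Xv.
have -> : #|{ffun T -> bool}|%:R * (deg X v)%:R = \sum_(e in Xv) #|{ffun T -> bool}|%:R :> R.
  by rewrite sumr_const mulr_natr.
apply: ler_sum => e eXv; rewrite exchange_big /= (bigD1 e) //=.
rewrite (eq_bigr (fun=> 1)); last by move=> w _; rewrite /xi; case: ifP => _; ring.
rewrite sumr_const gerDl; apply: sumr_le0 => f /andP[fXv fe].
have other g : g \in Xv -> exists2 u, u != v & g = [set v; u].
  rewrite inE => /andP[gX vg]; have /eqP/cards2P[a [b [ab gE]]] := sX _ gX; move: vg.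
  rewrite gE !inE => /orP[/eqP->|/eqP->]; first by exists b; rewrite // eq_sym.
  by exists a; rewrite // setUC.
have [u uv eE] := other e eXv; have [u' u'v fE] := other f fXv.
have uu' : u != u' by apply: contraNneq fe => uu'; rewrite eE fE uu'.
(* In a product over two edges at [v] the sign of [v] cancels, leaving the correlation of the two
   other ends. *)
have xiE w g x : g \in Xv -> g = [set v; x] -> xi w g = - (chi w v * chi w x).
  rewrite inE /xi => /andP[gX _] gE; rewrite gE crossing2 -gE gX /= /chi.
  by case: (side w v); case: (side w x); rewrite /= ?expr0 ?expr1; ring.
rewrite (eq_bigr (fun w => chi w u * chi w u')); first exact: sum_chi2.
move=> w _; rewrite (xiE _ _ _ eXv eE) (xiE _ _ _ fXv fE).
by rewrite mulrNN mulrACA -expr2 /chi sqrr_sign mul1r.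
Qed.

End RandomBipartition.

(** * Averaging over bipartitions and realizations *)

Section Sparsifier.
Local Open Scope ring_scope.
Variables (R : realFieldType) (T : finType).
Implicit Types (E F H Q X M : {set {set T}}) (e : {set T}).

Lemma mu_subset X (Y : {set {set T}}) : X \subset Y -> (mu X <= mu Y)%N.
Proof.
move=> sXY; have [M [sMX mM <-]] := mu_witness X.
exact: card_matching_le_mu (subset_trans sMX sXY) mM.
Qed.

(** Cutting halves the degrees, so the scale [2 * B] for [X] becomes [B] for the crossing edges, and
    the bipartite bound is averaged over all [w]. *)
Lemma edcs_matching_bound X M (B : R) (m : T -> R) :
  0 < B -> (forall v, 0 <= m v) -> simple_graph X ->
  is_matching M -> simple_graph M ->
  (forall e, e \in X -> \sum_(v in e) m v <= 2 * B) ->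
  (forall e, e \in M -> e \notin X -> 15 / 16 * (2 * B) <= \sum_(v in e) m v) ->
  #|M|%:R <= 7 / 4 * (mu X)%:R +
    43 / B ^+ 2 * \sum_v ((deg X v)%:R + ((deg X v)%:R - m v) ^+ 2).
Proof.
move=> B0 m0 sX mM sM mX mMX.
have B20 : 0 < 2 * B by lra.
pose D v := m v / (2 * B).
have sumD e : \sum_(v in e) D v = (\sum_(v in e) m v) / (2 * B) by rewrite mulr_suml.
pose N : R := #|{ffun T -> bool}|%:R.
have N0 : 0 < N by rewrite ltr0n; apply/card_gt0P; exists [ffun=> true].
pose Y w := crossing M w X.
have perw w : #|M|%:R <= 7 / 4 * (mu X)%:R +
    86 * \sum_v ((deg (Y w) v)%:R / B - D v) ^+ 2.
  have sY : Y w \subset X by apply/subsetP => e; rewrite inE => /andP[].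
  apply: le_trans (@bipartite_edcs_bound R T (Y w) M (left_side M w) B D B0 _ _ mM sM _ _) _.
  - by move=> v; rewrite divr_ge0 // ltW.
  - by move=> e; apply: crossing_bip.
  - move=> e /(subsetP sY) eX; rewrite sumD ler_pdivrMr // mul1r; exact: mX.
  - move=> e eM eY; rewrite sumD ler_pdivlMr //; apply: mMX => //.
    by apply: contra eY; apply: matching_crossing.
  by rewrite lerD2r ler_wpM2l ?ler_nat ?mu_subset //; lra.
have perv v : \sum_w ((deg (Y w) v)%:R / B - D v) ^+ 2 <=
    N * (((deg X v)%:R + ((deg X v)%:R - m v) ^+ 2) / (2 * B ^+ 2)).
  pose c : R := (2 * B ^+ 2)^-1.
  have c0 : 0 < c by rewrite invr_gt0 mulr_gt0 ?exprn_gt0 //; lra.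
  apply: (@le_trans _ _ (\sum_w c * ((2 * (deg (Y w) v)%:R - (deg X v)%:R) ^+ 2
                                     + ((deg X v)%:R - m v) ^+ 2))).
    apply: ler_sum => w _; rewrite /D.
    set a : R := (deg (Y w) v)%:R; set d : R := (deg X v)%:R.
    have -> : (a / B - m v / (2 * B)) ^+ 2 = c * ((2 * a - m v) ^+ 2 / 2).
      by rewrite /c; field; lra.
    apply: ler_wpM2l; first exact: ltW.
    (* [2a - m] splits into the bipartition error [2a - d] and the realization error [d - m]; the
       factor [c] turns 86 into 43. *)
    have := sqr_ge0 ((2 * a - d) - (d - m v)); lra.
  rewrite -big_distrr big_split /= sumr_const -[_ *+ #|_|]mulr_natl -/N.
  have := @crossing_deg_var R T M mM sM X v sX; rewrite -/N => h.
  rewrite -/c [leRHS](_ : _ = c * (N * (deg X v)%:R + N * ((deg X v)%:R - m v) ^+ 2)).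
    by apply: ler_wpM2l; [exact: ltW | rewrite lerD2r].
  by ring.
have avg : N * #|M|%:R <= N * (7 / 4 * (mu X)%:R) +
    86 * \sum_v (N * (((deg X v)%:R + ((deg X v)%:R - m v) ^+ 2) / (2 * B ^+ 2))).
  apply: (@le_trans _ _ (\sum_w (7 / 4 * (mu X)%:R +
    86 * \sum_v ((deg (Y w) v)%:R / B - D v) ^+ 2))).
    have -> : N * #|M|%:R = \sum_(w : {ffun T -> bool}) #|M|%:R.
      by rewrite sumr_const mulr_natl.
    by apply: ler_sum => w _; apply: perw.
  rewrite big_split /= sumr_const -[_ *+ #|_|]mulr_natl -/N lerD2l.
  rewrite -big_distrr /= exchange_big /=; apply: ler_wpM2l; first by lra.
  by apply: ler_sum => v _; apply: perv.
rewrite -(ler_pM2l N0); apply: le_trans avg _.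
rewrite -big_distrr -mulr_suml /= le_eqVlt; apply/orP; left; apply/eqP.
by field; lra.
Qed.

(** The [2 mu(X)] ends of a maximum matching meet every edge, since an edge missing them would
    extend the matching; each has degree at most [2B] plus its error, and the error is at most [2B]
    plus a squared term. *)
Lemma card_le_mu X (B : R) (m : T -> R) :
  0 < B -> (forall v, 0 <= m v) -> simple_graph X ->
  (forall e, e \in X -> \sum_(v in e) m v <= 2 * B) ->
  #|X|%:R <= 8 * B * (mu X)%:R + \sum_v ((deg X v)%:R - m v) ^+ 2 / (8 * B).
Proof.
move=> B0 m0 sX mX; have [M [sMX mM muM]] := mu_witness X.
pose A := cover M.
have tM := matching_trivIset mM.
have cA : #|A|%:R = 2 * (mu X)%:R :> R.
  have /eqP <- := tM; rewrite (eq_bigr (fun=> 2%N)) ?sum_nat_const ?muM ?natrM 1?mulrC //.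
  by move=> e eM; apply/sX/(subsetP sMX).
have meets e : e \in X -> exists2 v, v \in e & v \in A.
  move=> eX; case: (boolP [exists v in e, v \in A]) => [/exists_inP//|nA].
  have dis f v : f \in M -> v \in e -> v \notin f.
    move=> fM ve; apply: contra nA => vf; apply/exists_inP; exists v => //.
    by apply/bigcupP; exists f.
  have e0 : exists v, v \in e by apply/card_gt0P; rewrite sX.
  have eM : e \notin M by apply/negP => eM; have [v ve] := e0; have := dis e v eM ve; rewrite ve.
  have : (#|e |: M| <= mu X)%N.
    apply: card_matching_le_mu; first by rewrite subUset sub1set eX sMX.
    apply/forall_inP => f /setU1P fM; apply/forall_inP => g /setU1P gM; apply/implyP => fg.
    case: fM gM fg => [->|fM] [->|gM]; rewrite ?eqxx //= => fg; apply/pred0P => v /=.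
    - by apply/negP => /andP[ve]; apply/negP/dis.
    - by apply/negP => /andP[vf ve]; have := dis f v fM ve; rewrite vf.
    - apply/negP => /andP[vf vg]; by rewrite (matchingP mM fM gM vf vg) eqxx in fg.
  by rewrite cardsU1 eM muM add1n ltnn.
have leX : #|X|%:R <= \sum_(v in A) (deg X v)%:R :> R.
  have -> : \sum_(v in A) (deg X v)%:R = \sum_v (deg X v)%:R * (if v \in A then 1 else 0) :> R.
    by rewrite big_mkcond; apply: eq_bigr => v _; case: ifP; rewrite ?mulr1 ?mulr0.
  rewrite -sum_incidence -sum1_card natr_sum; apply: ler_sum => e eX.
  have [v ve vA] := meets e eX; rewrite (bigD1 v) //= vA lerDl.
  by apply: sumr_ge0 => u _; case: ifP.
apply: le_trans leX _.
apply: (@le_trans _ _ (\sum_(v in A) (4 * B + ((deg X v)%:R - m v) ^+ 2 / (8 * B)))).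
  apply: ler_sum => v /bigcupP[e eM ve].
  have mv : m v <= 2 * B.
    apply: le_trans (mX e (subsetP sMX _ eM)); rewrite (bigD1 v) //= lerDl.
    exact: sumr_ge0.
  have B20 : 0 < 2 * B by lra.
  have := normr_le_sqr ((deg X v)%:R - m v) B20.
  rewrite (_ : 4 * (2 * B) = 8 * B); last by ring.
  have := ler_norm ((deg X v)%:R - m v); lra.
rewrite big_split /= sumr_const -[_ *+ #|_|]mulr_natl cA.
apply: lerD; first by rewrite le_eqVlt; apply/orP; left; apply/eqP; ring.
rewrite [leRHS](bigID (mem A)) /= lerDl sumr_ge0 // => v _.
by rewrite divr_ge0 ?sqr_ge0 //; lra.
Qed.

Lemma stochastic_sparsifier (p : R) E : 0 < p < 1 -> simple_graph E ->
  exists Q, [/\ Q \subset E, forall v, (deg Q v)%:R <= 2 * (200 * 100) / p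
    & 52 / 100 * Ex p E (fun F => (mu F)%:R) <= Ex p Q (fun F => (mu F)%:R)].
Proof.
case/andP=> p0 p1 sE; pose B : R := 200 * 100.
have p01 : 0 <= p <= 1 by rewrite !ltW.
have pn0 : p != 0 by rewrite gt_eqF.
(* After scaling by [p], the degree sums are at most [2B] on [Q], and at least [2B - 2p], well above
   [15/16] of [2B], off [Q]. *)
have [Q [sQE upQ loQ]] := edcs_exists (2 * B / p - 1) sE.
exists Q; split=> //.
  move=> v; have [Qv0|/card_gt0P[e]] := posnP (deg Q v).
    by rewrite Qv0 divr_ge0 ?mulr_ge0 // ltW.
  rewrite inE => /andP[eQ ve]; have := upQ e eQ; rewrite (bigD1 v) //= subrK.
  by apply: le_trans; rewrite lerDl sumr_ge0.
pose m v : R := p * (deg Q v)%:R.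
have m0 v : 0 <= m v by rewrite mulr_ge0 // ltW.
have summ e : \sum_(v in e) m v = p * \sum_(v in e) (deg Q v)%:R by rewrite big_distrr.
have B0 : 0 < B by rewrite /B; lra.
have mQ e : e \in Q -> \sum_(v in e) m v <= 2 * B.
  move=> /upQ; rewrite subrK summ -(ler_pM2l p0) mulrCA divff // mulr1 /B; lra.
have mE e : e \in E -> e \notin Q -> 15 / 16 * (2 * B) <= \sum_(v in e) m v.
  move=> eE eQ; have := loQ e eE eQ; rewrite summ -(ler_pM2l p0).
  rewrite !mulrBr mulrCA divff // !mulr1 /B; lra.
have sQ F : simple_graph (F :&: Q).
  by move=> e; rewrite inE => /andP[_ /(subsetP sQE)]; apply: sE.
have pointwise F : F \subset E -> (mu F)%:R <= 7 / 4 * (mu (F :&: Q))%:R + 43 / B ^+ 2 *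
    \sum_v ((deg (F :&: Q) v)%:R + ((deg (F :&: Q) v)%:R - m v) ^+ 2).
  move=> sFE; have [M [sMF mM <-]] := mu_witness F.
  apply: edcs_matching_bound => //.
  - by move=> e /(subsetP sMF) /(subsetP sFE); apply: sE.
  - by move=> e; rewrite inE => /andP[_]; apply: mQ.
  - move=> e eM; rewrite inE (subsetP sMF _ eM) /=; apply: mE.
    exact: (subsetP sFE _ (subsetP sMF _ eM)).
have degI F v : deg (F :&: Q) v = #|F :&: [set e in Q | v \in e]|.
  by congr #|pred_of_set _|; apply/setP => e; rewrite !inE andbA.
have sQv v : [set e in Q | v \in e] \subset E.
  by apply: subset_trans sQE; apply/subsetP => e; rewrite inE => /andP[].
have Edeg v : Ex p E (fun F => (deg (F :&: Q) v)%:R) = m v.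
  rewrite /m [in RHS]/deg -Ex_card -(Ex_marginal _ _ (sQv v)).
  by apply: eq_Ex => F _; rewrite degI.
have Evar v : Ex p E (fun F => ((deg (F :&: Q) v)%:R - m v) ^+ 2) <= m v.
  pose g (G : {set {set T}}) : R := (#|G|%:R - p * (deg Q v)%:R) ^+ 2.
  rewrite (_ : Ex _ _ _ = p * (1 - p) * (deg Q v)%:R).
    by rewrite /m -mulrA ler_wpM2l ?(ltW p0) // ler_piMl // lerBlDr lerDl ltW.
  rewrite -Ex_var -(Ex_marginal p g (sQv v)).
  by apply: eq_Ex => F _; rewrite degI.
pose mQE := Ex p Q (fun F => (mu F)%:R).
have mQE_E : Ex p E (fun F => (mu (F :&: Q))%:R) = mQE.
  exact: (Ex_marginal p (fun F => (mu F)%:R) sQE).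
have summv : \sum_v m v = 2 * (p * #|Q|%:R).
  rewrite -big_distrr /= (eq_bigr (fun v => (deg Q v)%:R * 1)); last by move=> v; rewrite mulr1.
  rewrite -sum_incidence (eq_bigr (fun=> 2)).
    by rewrite sumr_const -[_ *+ #|_|]mulr_natl; ring.
  by move=> e eQ; rewrite sumr_const sE // (subsetP sQE).
(* Mean and variance of each degree are at most [m v], and the [m v] add up to [2p|Q|]. *)
have main : Ex p E (fun F => (mu F)%:R) <= 7 / 4 * mQE + 43 / B ^+ 2 * (4 * (p * #|Q|%:R)).
  apply: le_trans (le_Ex p01 pointwise) _.
  rewrite ExD !ExZ mQE_E lerD2l; apply: ler_wpM2l.
    by rewrite divr_ge0 ?exprn_ge0 // ltW.
  rewrite Ex_sum; apply: (@le_trans _ _ (\sum_v (m v + m v))).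
    by apply: ler_sum => v _; rewrite ExD Edeg lerD2l Evar.
  rewrite big_split /= summv; lra.
(* The last term is a tiny fraction of the left side, so [p|Q|] is of order [B] times [mQE]. *)
have size : p * #|Q|%:R <= 8 * B * mQE + 2 * (p * #|Q|%:R) / (8 * B).
  have -> : p * #|Q|%:R = Ex p E (fun F => #|F :&: Q|%:R).
    by rewrite (Ex_marginal p (fun F => #|F|%:R) sQE) Ex_card.
  apply: (@le_trans _ _ (Ex p E (fun F => 8 * B * (mu (F :&: Q))%:R +
     (8 * B)^-1 * \sum_v ((deg (F :&: Q) v)%:R - m v) ^+ 2))).
    apply: le_Ex => // F sFE; apply: le_trans (@card_le_mu _ B m B0 m0 _ _) _ => //.
      by move=> e; rewrite inE => /andP[_]; apply: mQ.
    by rewrite lerD2l -mulr_suml mulrC.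
  rewrite ExD !ExZ mQE_E lerD2l (Ex_marginal p (fun F => #|F|%:R) sQE) Ex_card.
  rewrite -summv [leRHS]mulrC; apply: ler_wpM2l; first by rewrite invr_ge0 mulr_ge0 ?ltW.
  by rewrite Ex_sum; apply: ler_sum => v _; apply: Evar.
have mQE0 : 0 <= mQE by rewrite -(Ex_cst p Q 0); apply: le_Ex.
(* The error is of order [1 / B] times [b]: here below [0.07 b], and [7/4 + 0.07 < 1/0.52]. *)
have concl (a b c : R) : 0 <= b -> a <= 7 / 4 * b + 43 / (200 * 100) ^+ 2 * (4 * c) ->
  c <= 8 * (200 * 100) * b + 2 * c / (8 * (200 * 100)) -> 52 / 100 * a <= b by lra.
exact: concl mQE0 main size.
Qed.

End Sparsifier.

(** * Passage to the real numbers of the statement *)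

Section Transfer.
Local Open Scope ring_scope.

Lemma expectE (T : finType) (p : Rdefinitions.R) (E : {set {set T}}) f :
  expect p E f = Ex p E (fun F => (f F)%:R%R).
Proof.
rewrite /expect /Ex; apply: eq_bigr => F _.
by rewrite /realization_prob !RpowE INRE.
Qed.

End Transfer.

From Stdlib Require Import Reals Lra.

Theorem theorem1 :
  exists p0 delta0 C : R,
    (0 < p0 < 1)%R /\ (0 < delta0)%R /\ (0 < C)%R /\
    forall (T : finType) (E : {set {set T}}),
      simple_graph E ->
      forall p : R, (0 < p < 1)%R ->
        exists Q : {set {set T}},
          Q \subset E /\
          (forall v : T, (INR (deg Q v) <= C * (1 + ln (1 / p)) / p)%R) /\
          ((p <= p0)%R ->
             (expect p Q (@mu T) >= (52 / 100) * expect p E (@mu T))%R) /\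
          (expect p Q (@mu T) >= (1 / 2 + delta0) * expect p E (@mu T))%R.
Proof.
(* Both ratios come from [52/100 = 1/2 + 2/100]; [40000 = 2 * 200 * 100] is the degree constant. *)
exists (/ 2)%R, (2 / 100)%R, 40000%R; do 3![split; first Lra.lra].
move=> T E sE p [p0 p1].
have p01 : is_true (Order.lt 0%R p && Order.lt p 1%R) by apply/andP; split; apply/RltP.
have [Q [sQE degQ /RleP]] := @stochastic_sparsifier _ T p E p01 sE.
rewrite -!expectE => h.
have {}h : (expect p Q (@mu T) >= 52 / 100 * expect p E (@mu T))%R.
  apply: Rle_ge; apply: Rle_trans h; apply: Req_le.
  rewrite -RmultE -RdivE -!INRE; congr Rmult; rewrite !INR_IZR_INZ /=; Lra.lra.
exists Q; split=> //; split; last by split=> [_|]; Lra.lra.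
move=> v; have /RleP := degQ v; rewrite -!INRE -RdivE -!RmultE => dv.
apply: Rle_trans dv _; rewrite !INR_IZR_INZ /=.
(* The degrees are at most [40000 / p], and the logarithmic factor is at least 1. *)
have lnp : (0 <= ln (1 / p))%R.
  rewrite /Rdiv Rmult_1_l ln_Rinv //; have := ln_increasing p 1 p0 p1.
  rewrite ln_1; Lra.lra.
have ip : (0 < / p)%R by apply: Rinv_0_lt_compat.
rewrite /Rdiv; apply: Rmult_le_compat_r; Lra.lra.
Qed.
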